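(* For every positive integer $n$, \[ \overline{q}(n)=\sum_{k=0}^{\infty}p\!\left(n-\frac{k(k+1)}{2}\right). \]
   Context: $p(n)$ is the number of (unrestricted) partitions of $n$, with $p(x)=0$ whenever $x$ is not a nonnegative integer. $\overline{q}(n)$ denotes the number of bipartitions of $n$ into distinct parts, i.e. $\sum_{n\ge0}\overline{q}(n)q^n=(-q;q)_\infty^2$, where $(a;q)_\infty=\prod_{k\ge1}(1-aq^{k-1})$. *)

(* Defs.v *)
From HB Require Import structures.
From mathcomp Require Import all_boot all_order all_algebra.
From mathcomp Require Import archimedean.

Set Implicit Arguments.
Unset Strict Implicit.
Unset Printing Implicit Defensive.

Import Order.TTheory GRing.Theory Num.Theory.

Definition is_partition (s : seq nat) : bool := sorted geq s && (0 \notin s).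

Definition is_partition_of (n : nat) (s : seq nat) : bool :=
  is_partition s && (sumn s == n).

(* A partition into distinct parts; the two components of a bipartition may
   still share parts, in agreement with the generating function
   (-q; q)_oo ^ 2. *)
Definition is_distinct_partition (s : seq nat) : bool :=
  is_partition s && uniq s.

Definition is_distinct_bipartition_of (n : nat) (st : seq nat * seq nat) :
    bool :=
  [&& is_distinct_partition st.1, is_distinct_partition st.2
    & sumn st.1 + sumn st.2 == n].

(* A partition of at most n has at most n parts, each at most n, so it is a
   bounded sequence over 'I_n.+1 (see partition_bseq). *)
Definition parts (n : nat) (t : n.-bseq 'I_n.+1) : seq nat :=
  map (@nat_of_ord n.+1) t.

Lemma parts_inj (n : nat) : injective (@parts n).
Proof. by move=> t u /(inj_map val_inj) /val_inj. Qed.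

Lemma partition_bseq (n : nat) (s : seq nat) :
  is_partition s -> sumn s <= n -> exists t : n.-bseq 'I_n.+1, parts t = s.
Proof.
move=> /andP[_ s0] le_sn.
have le_size : size s <= n.
  apply: leq_trans le_sn; elim: s s0 => //= x s IHs.
  rewrite inE negb_or eq_sym -lt0n => /andP[x0 /IHs].
  by rewrite -[(size s).+1]add1n; apply: leq_add.
have le_part x : x \in s -> x <= n.
  move=> xs; apply: leq_trans le_sn; elim: s xs {s0 le_size} => //= y s IHs.
  rewrite inE => /orP[/eqP->|/IHs]; first exact: leq_addr.
  by move=> h; apply: leq_trans h (leq_addl _ _).
have sz : size (map (@inord n) s) <= n by rewrite size_map.
exists (Bseq sz); rewrite /parts /= -map_comp -[RHS]map_id.
by apply/eq_in_map => x /le_part xn /=; rewrite inordK.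
Qed.

Definition npart (n : nat) : nat :=
  #|[set t : n.-bseq 'I_n.+1 | is_partition_of n (parts t)]|.

Definition p (x : rat) : nat :=
  if x \is a Num.nat then npart (Num.truncn x) else 0.

Definition qbar (n : nat) : nat :=
  #|[set tu : n.-bseq 'I_n.+1 * n.-bseq 'I_n.+1 |
      is_distinct_bipartition_of n (parts tu.1, parts tu.2)]|.

(* Main.v *)
Require Import Defs.
From HB Require Import structures.
From mathcomp Require Import all_boot all_order all_algebra.
From mathcomp Require Import all_classical all_reals all_analysis.
From mathcomp Require Import zify ring.

Set Implicit Arguments.
Unset Strict Implicit.
Unset Printing Implicit Defensive.

Import Order.TTheory GRing.Theory Num.Theory.
Local Open Scope ring_scope.

(* At [y = q^N, z = 1] the Gaussian binomial theorem expands the product of the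
   [q^N + q^i] for [i <= 2N], which is a power of [q] times
   [2 (-q; q)_N ^ 2].  After cancelling that power, the terms of index [N - j]
   and [N + 1 + j] both carry the triangular exponent [j (j + 1) / 2], and their
   Gaussian binomials count partitions inside a box.  For [N = n] the boxes do
   not constrain the partitions of [n - j (j + 1) / 2], so comparing
   coefficients of [q^n] and halving gives the identity. *)

(** * Generating polynomials of finite lists *)

Definition weight_poly (T : Type) (w : T -> nat) (L : seq T) : {poly int} :=
  \sum_(s <- L) 'X^(w s).

Lemma coef_weight_poly (T : Type) (w : T -> nat) (L : seq T) (n : nat) :
  (weight_poly w L)`_n = (count (fun s => w s == n) L)%:R.
Proof.
rewrite /weight_poly; elim: L => [|s L IH]; first by rewrite big_nil coef0.
by rewrite big_cons coefD IH coefXn /= natrD eq_sym.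
Qed.

(** Bridge from [npart] and [qbar], which are cardinals of sets of bounded sequences, to counts in
    explicit lists, whose generating polynomials satisfy recurrences. *)
Lemma card_preim_count (T : finType) (U : eqType) (f : T -> U) (Q : pred U)
    (L : seq U) :
  injective f -> uniq L -> {in Q, forall s, s \in L} ->
  {in Q, forall s, exists t, f t = s} ->
  #|[set t | Q (f t)]%SET| = count Q L.
Proof.
move=> f_inj uL QL Qf; rewrite cardE -(size_map f) -size_filter.
apply/perm_size/uniq_perm; first by rewrite map_inj_uniq // enum_uniq.
  exact: filter_uniq.
move=> s; rewrite mem_filter; apply/mapP/andP => [[t]|[Qs _]].
  by rewrite mem_enum inE => Qt ->; split=> //; apply: QL.
by have [t ft] := Qf s Qs; exists t; rewrite ?mem_enum ?inE ?ft.
Qed.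

(** * Gaussian binomials *)

(* The partitions with at most [a] parts, all of them at most [b], split
   according to whether the part [b] occurs. *)
Fixpoint box (a : nat) : nat -> seq (seq nat) :=
  fix box_a (b : nat) : seq (seq nat) :=
    match a, b with
    | a'.+1, b'.+1 => box_a b' ++ [seq b :: s | s <- box a' b]
    | _, _ => [:: [::]]
    end.

Lemma boxSS (a b : nat) :
  box a.+1 b.+1 = box a.+1 b ++ [seq b.+1 :: s | s <- box a b.+1].
Proof. by []. Qed.

Lemma box0n (b : nat) : box 0 b = [:: [::]].
Proof. by case: b. Qed.

Lemma mem_box (a b : nat) (s : seq nat) :
  (s \in box a b) = [&& path geq b s, 0%N \notin s & (size s <= a)%N].
Proof.
elim: a b s => [|a IHa] b; first by case=> [|x s]; rewrite box0n // !andbF.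
elim: b => [|b IHb] [|x s]; rewrite ?inE ?boxSS ?mem_cat ?IHb //=.
  by case: x => [|x] //=; rewrite ?andbF.
have -> : (x :: s \in [seq b.+1 :: s0 | s0 <- box a b.+1]) =
    (x == b.+1) && (s \in box a b.+1).
  apply/mapP/andP => [[s' s'L [-> ->]]|[/eqP-> sL]]; first by rewrite eqxx.
  by exists s.
rewrite IHa inE; case: (eqVneq x b.+1) => [->|neq] /=.
  by rewrite ltnn leqnn /= ltnS.
rewrite orbF; congr (_ && _ && _); lia.
Qed.

Lemma uniq_box (a b : nat) : uniq (box a b).
Proof.
elim: a b => [|a IHa] b; first by rewrite box0n.
elim: b => [//|b IHb]; rewrite boxSS cat_uniq IHb map_inj_uniq ?IHa ?andbT;
  last by move=> ? ? [].
by apply/hasPn => s /mapP[s' _ ->]; rewrite mem_box /= ltnn.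
Qed.

(** The Gaussian binomial coefficient of [a + b] over [a] with [q = 'X]; counting partitions avoids
    a quotient of q-factorials. *)
Definition gauss (a b : nat) : {poly int} := weight_poly sumn (box a b).

Lemma gaussn0 (a : nat) : gauss a 0 = 1.
Proof. by case: a => [|a]; rewrite /gauss /weight_poly big_seq1. Qed.

Lemma gauss0n (b : nat) : gauss 0 b = 1.
Proof. by rewrite /gauss /weight_poly box0n big_seq1. Qed.

(** The q-Pascal rule, read off from the two halves of [box]. *)
Lemma gaussSS (a b : nat) :
  gauss a.+1 b.+1 = gauss a.+1 b + 'X^(b.+1) * gauss a b.+1.
Proof.
rewrite /gauss /weight_poly boxSS big_cat /= big_map mulr_sumr; congr (_ + _).
by apply: eq_bigr => s _; rewrite -exprD.
Qed.

Lemma size_le_sumn (s : seq nat) : 0%N \notin s -> (size s <= sumn s)%N.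
Proof.
elim: s => //= x s IHs; rewrite inE negb_or => /andP[x0 /IHs]; lia.
Qed.

Lemma path_geq_sumn (n : nat) (s : seq nat) :
  sorted geq s -> (sumn s <= n)%N -> path geq n s.
Proof.
case: s => //= x s ->; rewrite andbT => h.
by apply: leq_trans h; exact: leq_addr.
Qed.

(** A partition of [n] has at most [n] parts, each at most [n], so it fits in the box. *)
Lemma npartE (a b n : nat) : (n <= a)%N -> (n <= b)%N ->
  npart n = count (fun s => sumn s == n) (box a b).
Proof.
move=> na nb; rewrite /npart (card_preim_count (L := box a b)).
- apply: eq_in_count => s; rewrite mem_box /is_partition_of /is_partition.
  by case/and3P => /path_sorted -> ->.
- exact: parts_inj.
- exact: uniq_box.
- move=> s /andP[/andP[s_sorted s0] /eqP sn].
  rewrite mem_box s0 path_geq_sumn ?sn //=.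
  by apply: leq_trans (size_le_sumn s0) _; rewrite sn.
- by move=> s /andP[sP /eqP sn]; apply: partition_bseq; rewrite ?sn.
Qed.

Lemma coef_gauss (a b n : nat) : (n <= a)%N -> (n <= b)%N ->
  (gauss a b)`_n = (npart n)%:R.
Proof. by move=> na nb; rewrite coef_weight_poly -npartE. Qed.

Lemma bin2D (a b : nat) : 'C(a + b, 2) = ('C(a, 2) + 'C(b, 2) + a * b)%N.
Proof.
elim: a => [|a IHa]; first by rewrite bin0n mul0n addn0.
by rewrite addSn !binS !bin1 IHa; lia.
Qed.

Lemma bin2_succ_double (k : nat) : ('C(k.+1, 2) * 2 = k * k.+1)%N.
Proof. by elim: k => // k IHk; rewrite binS bin1; lia. Qed.

(** Induction on [M]: in the product with the new factor [y + z * 'X^M], term [k] collects the old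
    term [k] times [y] and the old term [k - 1] times [z * 'X^M]. *)
Lemma gauss_binomial (y z : {poly int}) (M : nat) :
  \prod_(i < M) (y + z * 'X^i) =
  \sum_(k < M.+1) 'X^'C(k, 2) * gauss k (M - k) * z ^+ k * y ^+ (M - k).
Proof.
elim: M => [|M IHM].
  by rewrite big_ord0 big_ord1 gauss0n !mulr1.
rewrite big_ord_recr /= {}IHM mulrDr !mulr_suml.
rewrite [RHS]big_ord_recl [in RHS]big_ord_recr /=.
rewrite [X in X + _]big_ord_recl [X in _ + X]big_ord_recr /=.
rewrite -addrA [X in _ + X]addrA -big_split /=; congr (_ + (_ + _)).
- by rewrite !subn0 !gauss0n exprSr; ring.
- apply: eq_bigr => -[i iM] _; rewrite /= /bump /= add1n subSS.
  (* With [M = d + i.+1], the exponent ['C(i, 2) + M] equals ['C(i.+1, 2) + d.+1], as the q-Pascal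
     rule requires. *)
  have /subnK := iM; move: (M - i.+1)%N => d <-.
  have -> : (d + i.+1 - i = d.+1)%N by lia.
  by rewrite gaussSS binS bin1 !exprD !exprS; ring.
- by rewrite /bump leq0n add1n !subnn !gaussn0 binS bin1 !exprD !exprS; ring.
Qed.

(** * Partitions into distinct parts *)

(** The split according to whether the part [N] occurs mirrors the factor [1 + 'X^N]. *)
Fixpoint distinct_box (N : nat) : seq (seq nat) :=
  if N is N'.+1 then distinct_box N' ++ [seq N :: s | s <- distinct_box N']
  else [:: [::]].

Lemma mem_distinct_box (N : nat) (s : seq nat) :
  (s \in distinct_box N) = path gtn N.+1 s && (0%N \notin s).
Proof.
elim: N s => [|N IHN] [|x s] /=; rewrite ?inE ?mem_cat ?IHN //=.
  by case: x => [|x] //=; rewrite ?andbF.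
have -> : (x :: s \in [seq N.+1 :: s0 | s0 <- distinct_box N]) =
    (x == N.+1) && (s \in distinct_box N).
  apply/mapP/andP => [[s' s'L [-> ->]]|[/eqP-> sL]]; first by rewrite eqxx.
  by exists s.
rewrite IHN inE; case: (eqVneq x N.+1) => [->|neq] /=.
  by rewrite ltnn ltnSn.
rewrite orbF; congr (_ && _ && _); lia.
Qed.

Lemma uniq_distinct_box (N : nat) : uniq (distinct_box N).
Proof.
elim: N => //= N IHN; rewrite cat_uniq IHN map_inj_uniq ?IHN ?andbT /=;
  last by move=> ? ? [].
by apply/hasPn => s /mapP[s' _ ->]; rewrite mem_distinct_box /= ltnn.
Qed.

Lemma is_distinct_partitionE (s : seq nat) :
  is_distinct_partition s = sorted gtn s && (0%N \notin s).
Proof.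
rewrite /is_distinct_partition /is_partition gtn_sorted_uniq_geq.
by rewrite andbAC [uniq s && _]andbC.
Qed.

Lemma weight_poly_distinct_box (N : nat) :
  weight_poly sumn (distinct_box N) = \prod_(i < N) (1 + 'X^(i.+1)).
Proof.
elim: N => [|N IHN]; first by rewrite /weight_poly big_ord0 big_seq1.
rewrite big_ord_recr /= -IHN /weight_poly /= big_cat big_map /= mulrDr mulr1.
congr (_ + _); rewrite mulr_suml; apply: eq_bigr => s _.
by rewrite -exprD addnC.
Qed.

Lemma mem_distinct_box_sumn (n : nat) (s : seq nat) :
  is_distinct_partition s -> (sumn s <= n)%N -> s \in distinct_box n.
Proof.
rewrite is_distinct_partitionE mem_distinct_box => /andP[+ ->].
case: s => //= x s -> h; rewrite !andbT ltnS.
by apply: leq_trans h; exact: leq_addr.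
Qed.

(** The infinite product may be cut after [n] factors because no component of a bipartition of [n]
    has a part above [n]. *)
Lemma coef_qbar (n : nat) :
  ((\prod_(i < n) (1 + 'X^(i.+1)) : {poly int}) ^+ 2)`_n = (qbar n)%:R.
Proof.
pose w (st : seq nat * seq nat) := (sumn st.1 + sumn st.2)%N.
pose L := [seq (s, t) | s <- distinct_box n, t <- distinct_box n].
have -> : (\prod_(i < n) (1 + 'X^(i.+1)) : {poly int}) ^+ 2 = weight_poly w L.
  rewrite -weight_poly_distinct_box /weight_poly /L expr2.
  rewrite big_allpairs_dep big_distrl; apply: eq_bigr => s _ /=.
  by rewrite mulr_sumr; apply: eq_bigr => t _; rewrite -exprD.
rewrite coef_weight_poly /qbar; congr (_%:R); apply/esym.
have f_inj : injective (fun tu : n.-bseq 'I_n.+1 * n.-bseq 'I_n.+1 =>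
    (parts tu.1, parts tu.2)).
  by move=> [t u] [t' u'] /= [/parts_inj-> /parts_inj->].
rewrite (card_preim_count (Q := is_distinct_bipartition_of n) (L := L) f_inj).
- apply: eq_in_count => st /allpairsP[[s t] /= [sD tD ->]].
  rewrite /is_distinct_bipartition_of /=.
  rewrite !is_distinct_partitionE; move: sD tD; rewrite !mem_distinct_box.
  by move=> /andP[/path_sorted-> ->] /andP[/path_sorted-> ->].
- by apply: allpairs_uniq; rewrite ?uniq_distinct_box // => -[? ?] [? ?].
- move=> [s t] /and3P[/= sP tP /eqP stn].
  by apply/allpairsP; exists (s, t); split=> //=;
    apply: mem_distinct_box_sumn => //; lia.
- move=> [s t] /and3P[/= /andP[sP _] /andP[tP _] /eqP stn].
  have [|t1 <-] := @partition_bseq n s sP; first lia.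
  have [|t2 <-] := @partition_bseq n t tP; first lia.
  by exists (t1, t2).
Qed.

(** * The finite Jacobi triple product *)

(** The factor [i = N] is [2 q^N]; those below it give up [q^i], in total ['C(N, 2)], and those
    above it give up [q^N] each, in total [N * N]. *)
Lemma prod_centered (N : nat) :
  \prod_(i < N.*2.+1) ('X^N + 1 * 'X^i : {poly int}) =
  'X^('C(N, 2) + N + N * N) * ((\prod_(i < N) (1 + 'X^(i.+1))) ^+ 2 *+ 2).
Proof.
under eq_bigr do rewrite mul1r.
rewrite -addnn -addnS big_split_ord /= big_ord_recl /= addn0.
rewrite -mulr2n (reindex_inj rev_ord_inj) /=.
have -> : \prod_(j < N) ('X^N + 'X^(N - j.+1)) =
    'X^'C(N, 2) * \prod_(i < N) (1 + 'X^(i.+1)) :> {poly int}.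
  rewrite -bin2_sum big_mkord expr_sum.
  rewrite [X in X * _](reindex_inj rev_ord_inj) -big_split.
  apply: eq_bigr => i _ /=.
  by rewrite mulrDr mulr1 -exprD subnK // addrC.
have -> : \prod_(i < N) ('X^N + 'X^(N + bump 0 i)) =
    'X^(N * N) * \prod_(i < N) (1 + 'X^(i.+1)) :> {poly int}.
  have -> : 'X^(N * N) = \prod_(i < N) 'X^N :> {poly int}.
    by rewrite prodr_const card_ord exprM.
  rewrite -big_split.
  by apply: eq_bigr => i _ /=; rewrite mulrDr mulr1 -exprD /bump.
rewrite !exprD expr2; move: 'X^_ 'X^N 'X^_ (\prod_(i < N) _) => A B C P.
by ring.
Qed.

Lemma finite_triple_product (N : nat) :
  (\prod_(i < N) (1 + 'X^(i.+1))) ^+ 2 *+ 2 =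
  \sum_(j < N.+1) 'X^'C(j.+1, 2) *
    (gauss (N - j) (N.+1 + j) + gauss (N.+1 + j) (N - j)) :> {poly int}.
Proof.
apply: (@mulfI _ 'X^('C(N, 2) + N + N * N)).
  by rewrite expf_neq0 ?polyX_eq0.
rewrite -prod_centered gauss_binomial -addnn -addnS -addSn big_split_ord /=.
(* Reversing the lower half pairs index [N - j] with index [N.+1 + j]. *)
rewrite (reindex_inj rev_ord_inj) -big_split mulr_sumr.
apply: eq_bigr => j _ /=.
have jN : (j <= N)%N by rewrite -ltnS.
rewrite !expr1n !mulr1 -!exprM subSS.
have -> : (N + N.+1 - (N - j) = N.+1 + j)%N by lia.
have -> : (N + N.+1 - (N.+1 + j) = N - j)%N by lia.
(* The exponent ['C(k, 2) + N * (N.*2.+1 - k)] takes the same value at both paired indices [k]: the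
   power to cancel plus ['C(j.+1, 2)]. *)
have E1 : ('C(N, 2) + N + N * N + 'C(j.+1, 2) =
    'C(N - j, 2) + N * (N.+1 + j))%N.
  have := bin2D (N - j) j; have := bin2_succ_double j.
  rewrite subnK // binS bin1; have := subnK jN.
  by move: (N - j)%N (nat_of_ord j) => d i <- Ti ->; lia.
have E2 : ('C(N, 2) + N + N * N + 'C(j.+1, 2) =
    'C(N.+1 + j, 2) + N * (N - j))%N.
  rewrite addSnnS bin2D mulnBr; have : (N * j <= N * N)%N by rewrite leq_mul.
  by lia.
by rewrite mulrA -exprD mulrDr {1}E1 E2 !exprD; ring.
Qed.

(** * Comparison of coefficients and the series *)

Lemma qbarE (n : nat) :
  qbar n = (\sum_(j < n.+1 | 'C(j.+1, 2) <= n) npart (n - 'C(j.+1, 2)))%N.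
Proof.
have /(congr1 (fun P : {poly int} => P`_n)) := finite_triple_product n.
rewrite coefMn coef_qbar coef_sum => E; apply/eqP.
rewrite -(eqr_nat int) -(eqr_pMn2r (ltn0Sn 1)) E natr_sum -sumrMnl.
rewrite [eqbRHS]big_mkcond; apply/eqP/eq_bigr => j _.
rewrite coefXnM ltnNge; case: leqP => //= Tn.
(* Hence both box sides [n - j] and [n.+1 + j] are at least [n - 'C(j.+1, 2)], and the two Gaussian
   binomials contribute the same [npart]. *)
have jT : (j <= 'C(j.+1, 2))%N by rewrite binS bin1 leq_addl.
by rewrite coefD !coef_gauss //; lia.
Qed.

(** The test singles out the negative arguments, where [p] is 0 while truncated subtraction would
    yield [npart 0 = 1]. *)
Lemma p_triangular (n k : nat) :
  p (n%:R - k%:R * (k%:R + 1) / 2) =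
  if ('C(k.+1, 2) <= n)%N then npart (n - 'C(k.+1, 2)) else 0%N.
Proof.
have -> : k%:R * (k%:R + 1) / 2 = 'C(k.+1, 2)%:R :> rat.
  have /(congr1 (fun m => m%:R : rat)) := bin2_succ_double k.
  rewrite !natrM -[k.+1%:R]natr1 => E.
  by rewrite -E mulfK.
rewrite /p; case: leqP => Tn; first by rewrite -natrB // natr_nat natrK.
case: ifPn => // /natr_ge0; rewrite subr_ge0 ler_nat; lia.
Qed.

Theorem theorem3p10 (R : realType) (n : nat) (hn : (0 < n)%N) :
  ((qbar n)%:R%:E : \bar R) =
  (\sum_(0 <= k <oo) ((p (n%:R - k%:R * (k%:R + 1) / 2)%R)%:R)%:E)%E.
Proof.
(* From [k = n.+1] on, the triangular number is at least [k > n], so the tail of the series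
   vanishes. *)
rewrite (nneseries_split 0 n.+1); last by move=> k _; rewrite lee_fin.
rewrite add0n eseries0 ?adde0; last first.
  move=> k nk _; rewrite p_triangular; case: leqP => // Tn.
  have kT : (k <= 'C(k.+1, 2))%N by rewrite binS bin1 leq_addl.
  lia.
rewrite big_mkord sumEFin qbarE -natr_sum big_mkcond.
by under [in RHS]eq_bigr do rewrite p_triangular.
Qed.
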